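(* Assume the Green's functions $G_P[2T]$, $G_N[T]$, $G_D[T]$ exist. Let $\sigma_1,\sigma_2\in L^1(I)$, let $u_N$ be the unique solution of $Lu=\sigma_1$ a.e. on $I$, $u\in X_{N,T}$, and $u_D$ the unique solution of $Lu=\sigma_2$ a.e. on $I$, $u\in X_{D,T}$. Then: 1. If $G_P[2T]\ge0$ on $J\times J$ and $|\sigma_2(t)|\le\sigma_1(t)$ for a.e. $t\in I$, then $|u_D(t)|\le u_N(t)$ for all $t\in I$. 2. If $G_P[2T]\le0$ on $J\times J$ and $0\le\sigma_2(t)\le\sigma_1(t)$ for a.e. $t\in I$, then $u_N(t)\le0$ and $u_N(t)\le u_D(t)$ for all $t\in I$. 3. If $G_P[2T]\le0$ on $J\times J$ and $\sigma_1(t)\le\sigma_2(t)\le0$ for a.e. $t\in I$, then $u_N(t)\ge0$ and $u_D(t)\le u_N(t)$ for all $t\in I$.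
   Context: Fix $n\ge 1$, $T>0$, $I=[0,T]$, $J=[0,2T]$. $W^{2n,1}(K)$: $u\in C^{2n-1}(K)$ with $u^{(2n-1)}$ absolutely continuous. Let $a_0,\dots,a_{2n-1}\in L^\alpha(I)$, $\alpha\ge1$, $Lu=u^{(2n)}+\sum_{k=0}^{2n-1}a_ku^{(k)}$ on $I$. $\widetilde L u=u^{(2n)}+\sum_{k=0}^{n-1}(\hat a_{2k+1}u^{(2k+1)}+\tilde a_{2k}u^{(2k)})$ on $J$, where $\tilde a_{2k}=a_{2k}$, $\hat a_{2k+1}=a_{2k+1}$ on $I$, and $\tilde a_{2k}(t)=a_{2k}(2T-t)$, $\hat a_{2k+1}(t)=-a_{2k+1}(2T-t)$ for $t\in(T,2T]$. An operator $M$ is nonresonant in $X$ if $Mu=0$ a.e., $u\in X$ forces $u\equiv0$; its Green's function $G$ then gives the unique solution $u(t)=\int G(t,s)\sigma(s)ds$ of $Mu=\sigma$, $u\in X$. $X_{N,T}=\{u\in W^{2n,1}(I): u^{(2k+1)}(0)=u^{(2k+1)}(T)=0,\ k=0,\dots,n-1\}$, $X_{D,T}=\{u\in W^{2n,1}(I): u^{(2k)}(0)=u^{(2k)}(T)=0,\ k=0,\dots,n-1\}$; $G_N[T]$, $G_D[T]$ are the Green's functions of $L$ on these spaces. $G_P[2T]$: Green's function of $\widetilde L$ on $\{u\in W^{2n,1}(J): u^{(k)}(0)=u^{(k)}(2T),\ k=0,\dots,2n-1\}$. *)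

(* Defs.v *)
From HB Require Import structures.
From mathcomp Require Import all_boot all_order all_algebra.
From mathcomp Require Import all_classical all_reals all_analysis.
Set Implicit Arguments. Unset Strict Implicit. Unset Printing Implicit Defensive.
Import Order.TTheory GRing.Theory Num.Theory.
Import numFieldNormedType.Exports.
Local Open Scope classical_set_scope.
Local Open Scope ring_scope.

Section Defs.
Variable R : realType.
Local Notation mu := (@lebesgue_measure R).

Definition abs_cont_on (lo hi : R) (f : R -> R) : Prop :=
  forall e : R, 0 < e -> exists2 d : R, 0 < d &
    forall (k : nat) (x y : 'I_k -> R),
      (forall i, lo <= x i /\ x i <= y i /\ y i <= hi) ->
      (forall i j : 'I_k, (i < j)%N -> y i <= x j) ->
      \sum_(i < k) (y i - x i) < d ->
      \sum_(i < k) `|f (y i) - f (x i)| < e.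

(* W^{2n,1}([lo,hi]), represented by functions R -> R which are C^{2n-1} on R
   (every element of W^{2n,1}([lo,hi]) has such an extension) whose
   (2n-1)-th derivative is absolutely continuous on [lo,hi]. *)
Definition W2n1 (n : nat) (lo hi : R) (u : R -> R) : Prop :=
  (forall k, (k < (2 * n).-1)%N -> forall t, derivable (derive1n k u) t 1) /\
  continuous (derive1n (2 * n).-1 u) /\
  abs_cont_on lo hi (derive1n (2 * n).-1 u).

Definition Lop (n : nat) (a : nat -> R -> R) (u : R -> R) (t : R) : R :=
  derive1n (2 * n) u t + \sum_(k < 2 * n) a k t * derive1n k u t.

Definition aext (T : R) (a : nat -> R -> R) (k : nat) (t : R) : R :=
  if t <= T then a k t
  else if odd k then - a k (2 * T - t) else a k (2 * T - t).

Definition XN (n : nat) (T : R) (u : R -> R) : Prop :=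
  W2n1 n 0 T u /\ forall k, (k < n)%N ->
    derive1n (2 * k).+1 u 0 = 0 /\ derive1n (2 * k).+1 u T = 0.

Definition XD (n : nat) (T : R) (u : R -> R) : Prop :=
  W2n1 n 0 T u /\ forall k, (k < n)%N ->
    derive1n (2 * k) u 0 = 0 /\ derive1n (2 * k) u T = 0.

Definition XP (n : nat) (T' : R) (u : R -> R) : Prop :=
  W2n1 n 0 T' u /\ forall k, (k < 2 * n)%N ->
    derive1n k u 0 = derive1n k u T'.

Definition nonresonant (M : (R -> R) -> R -> R) (X : (R -> R) -> Prop)
    (lo hi : R) : Prop :=
  forall u, X u -> {ae mu, forall t, `[lo, hi]%classic t -> M u t = 0} ->
    forall t, `[lo, hi]%classic t -> u t = 0.

Definition green_fun (M : (R -> R) -> R -> R) (X : (R -> R) -> Prop)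
    (lo hi : R) (G : R -> R -> R) : Prop :=
  nonresonant M X lo hi /\
  forall sigma : R -> R, mu.-integrable `[lo, hi]%classic (EFin \o sigma) ->
    exists u, [/\ X u,
      {ae mu, forall t, `[lo, hi]%classic t -> M u t = sigma t} &
      forall t, `[lo, hi]%classic t ->
        ((u t)%:E = \int[mu]_(s in `[lo, hi]%classic) (G t s * sigma s)%:E)%E].

Definition Lalpha (alpha : \bar R) (T : R) (f : R -> R) : Prop :=
  measurable_fun `[0, T]%classic f /\
  (Lnorm mu alpha (EFin \o (f \_ (`[0%R, T]%classic : set R))) < +oo)%E.

End Defs.

(* Main.v *)
(* Write v for the even reflection of u_N about T and w for the odd reflection of
   u_D. Both satisfy the periodic boundary conditions on J = [0, 2T], and L~ maps
   them to the even (resp. odd) reflection of sigma_1 (resp. sigma_2). By linearity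
   and nonresonance, any combination z of v and w is the Green integral of L~ z, so
   each comparison follows from a sign of G_P and of a combination of the reflected
   right-hand sides, applied to z = v + w, v - w, w - v, v or -v.

   Linearity of L~ holds only almost everywhere and requires the top derivatives,
   which are merely absolutely continuous, to be differentiable a.e. For this, an
   absolutely continuous f is a difference of nondecreasing absolutely continuous
   functions (the total variation V and V - f); the Stieltjes measure of such a
   function is dominated by the Lebesgue measure, hence has a Radon-Nikodym density,
   and Lebesgue differentiation applies. *)
Require Import Defs.
From HB Require Import structures.
From mathcomp Require Import all_boot all_order all_algebra.
From mathcomp Require Import all_classical all_reals all_analysis.
From mathcomp Require Import measurable_realfun ring lra.
Set Implicit Arguments.
Unset Strict Implicit.
Unset Printing Implicit Defensive.
Import Order.TTheory GRing.Theory Num.Theory.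
Import numFieldNormedType.Exports.
Local Open Scope classical_set_scope.
Local Open Scope ring_scope.

(** * Absolutely continuous functions as differences of monotone ones *)

Section Chain.
Context {R : realType}.
Implicit Types (a b c : R) (s t : seq (R * R)) (f : R -> R).

(* [chain a [:: (x1, y1); (x2, y2)] b] means a <= x1 <= y1 <= x2 <= y2 <= b. *)
Fixpoint chain a s b : bool :=
  if s is p :: s' then [&& a <= p.1, p.1 <= p.2 & chain p.2 s' b] else a <= b.

Lemma chain_le a s b : chain a s b -> a <= b.
Proof.
elim: s a => [//|p s IH] a /= /and3P[ap pp /IH pb].
exact: le_trans ap (le_trans pp pb).
Qed.

Lemma chain_cat a s c t b : chain a s c -> chain c t b -> chain a (s ++ t) b.
Proof.
move=> + ct; elim: s a => [|p s IH] a /=.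
  by case: t ct => [|q t] /=; [move=> cb ac; exact: le_trans ac cb|
    move=> /and3P[cq -> ->] ac; rewrite (le_trans ac cq)].
by move=> /and3P[-> -> /IH ->].
Qed.

Lemma chain_widen a a' s b b' : a' <= a -> b <= b' -> chain a s b ->
  chain a' s b'.
Proof.
move=> aa bb sc; rewrite -[s]/([::] ++ s) -[s]cats0.
by apply: (@chain_cat _ _ a) => //; apply: (chain_cat sc).
Qed.

Lemma chain_nth a s b i : chain a s b -> (i < size s)%N ->
  [/\ a <= (nth (a, a) s i).1, (nth (a, a) s i).1 <= (nth (a, a) s i).2
    & (nth (a, a) s i).2 <= b].
Proof.
elim: s a i => [//|p s IH] a [|i] /= /and3P[ap pp cs].
  by split=> //; exact: chain_le cs.
rewrite ltnS => si; rewrite (set_nth_default (p.2, p.2))//.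
have [h1 h2 h3] := IH _ _ cs si; split=> //.
exact: le_trans (le_trans ap pp) h1.
Qed.

Lemma chain_nth_lt a s b i j : chain a s b -> (i < j < size s)%N ->
  (nth (a, a) s i).2 <= (nth (a, a) s j).1.
Proof.
elim: s a i j => [|p s IH] a i j; first by rewrite ltn0 andbF.
case: j => [|j]; first by rewrite ltn0.
rewrite /= => /and3P[ap pp cs]; rewrite ltnS => /andP[ij js].
rewrite (set_nth_default (p.2, p.2) (a, a) js).
case: i ij => [|i] /= ij; first by case: (chain_nth cs js).
move: ij js; rewrite !ltnS => ij js.
rewrite (set_nth_default (p.2, p.2)); first by apply: IH => //; rewrite ij.
exact: ltn_trans js.
Qed.

Definition chain_len s : R := \sum_(p <- s) (p.2 - p.1).
Definition chain_var f s : R := \sum_(p <- s) `|f p.2 - f p.1|.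

(** Lists replace the families indexed by ['I_k] of [abs_cont_on], so that intervals can be
    concatenated and inductions run on the list. *)
Definition chain_abs_cont (lo hi : R) f : Prop :=
  forall e : R, 0 < e -> exists2 d : R, 0 < d &
    forall s, chain lo s hi -> chain_len s < d -> chain_var f s < e.

Lemma abs_cont_on_chain (lo hi : R) f : abs_cont_on lo hi f ->
  chain_abs_cont lo hi f.
Proof.
move=> ac e e0; have [d d0 H] := ac e e0; exists d => // s cs.
rewrite /chain_len /chain_var !(big_nth (lo, lo)) !big_mkord; apply: (H (size s)).
  by move=> i; have [] := chain_nth cs (ltn_ord i).
by move=> i j ij; apply: (chain_nth_lt cs); rewrite ij /=.
Qed.

(** Consecutive points of a partition bound adjacent intervals. This lets the sums whose supremum is
    the total variation enter the epsilon-delta condition. *)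
Lemma chain_partition (a b : R) f (s : seq R) : itv_partition a b s ->
  exists t, [/\ chain a t b, chain_len t = b - a & chain_var f t = variation a b f s].
Proof.
elim: s a => [|x s IH] a.
  case=> _ /= /eqP <-; exists [::]; split => //=.
    by rewrite /chain_len big_nil subrr.
  by rewrite /chain_var /variation !big_nil.
case=> /= /andP[ax ps] ls.
have [t [ct lt vt]] := IH x (conj ps ls).
exists ((a, x) :: t); split.
- by rewrite /= lexx ltW.
- by rewrite /chain_len big_cons /= -/(chain_len t) lt addrC subrKA.
- rewrite /chain_var big_cons -/(chain_var f t) vt /variation /= big_nat_recl//.
Qed.
End Chain.

(** * Total variation of an absolutely continuous function *)

Section AbsContBV.
Context {R : realType}.
Implicit Types (a b : R) (s t : seq (R * R)) (f : R -> R).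
Variables (lo hi : R) (f : R -> R).
Hypotheses (lohi : lo <= hi) (acf : chain_abs_cont lo hi f).

Local Notation TV := total_variation.

Lemma chain_len_cat s t : chain_len (s ++ t) = chain_len s + chain_len t :> R.
Proof. by rewrite /chain_len big_cat. Qed.

Lemma chain_var_cat g s t : chain_var g (s ++ t) = chain_var g s + chain_var g t :> R.
Proof. by rewrite /chain_var big_cat. Qed.

(** Partitioning each interval of a chain keeps its total length, so the same [d] controls every
    refinement; taking suprema over the partitions makes the bound non-strict. *)
Lemma chain_abs_cont_tv (e : R) : 0 < e -> exists2 d : R, 0 < d &
  forall s, chain lo s hi -> chain_len s < d ->
  (\sum_(p <- s) TV p.1 p.2 f <= e%:E)%E.
Proof.
move=> e0; have [d d0 H] := acf e0; exists d => // s cs sd.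
(* The chain [t], whose variation is already bounded, absorbs a partition of the
   first interval of [s] at each step of the induction on [s]. *)
suff K a t : chain lo t a -> chain a s hi -> chain_len t + chain_len s < d ->
    ((chain_var f t)%:E + \sum_(p <- s) TV p.1 p.2 f <= e%:E)%E.
  have := K lo [::].
  rewrite /chain_var/= lexx /chain_len !big_nil !add0r => /(_ isT cs).
  exact.
elim: s a t {cs sd} => [|p s IH] a t ct /=.
  move=> ahi; rewrite /chain_len !big_nil addr0 adde0 lee_fin => td.
  apply/ltW/H => //.
  exact: chain_widen ct.
move=> /and3P[ap pp cs].
rewrite {2}/chain_len !big_cons -/(chain_len s) => td.
have p0 : 0 <= p.2 - p.1 by rewrite subr_ge0.
have : ((chain_var f t)%:E + \sum_(p <- s) TV p.1 p.2 f <= e%:E)%E.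
  apply: (IH p.2) => //; first by apply: chain_widen ct => //; exact: le_trans pp.
  by apply: le_lt_trans td; rewrite lerD2l lerDr.
have S0 : (0 <= \sum_(p <- s) TV p.1 p.2 f)%E.
  clear -cs lohi; elim: s (p.2) cs => [|q s IH] a; first by rewrite big_nil.
  by move=> /= /and3P[_ ? /IH ?]; rewrite big_cons adde_ge0// total_variation_ge0.
(* The value -oo is excluded by [S0], and +oo by the bound just obtained from the induction
   hypothesis. *)
move: S0 IH; case: (\sum_(p <- s) _)%E => [S| |]; last by [].
- move=> S0 IH _.
  suff : (TV p.1 p.2 f <= (e - chain_var f t - S)%:E)%E.
    move=> h; apply: (@le_trans _ _ ((chain_var f t)%:E +
      ((e - chain_var f t - S)%:E + S%:E))%E).
      by rewrite leeD2l// leeD2r.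
    by rewrite -!EFinD lee_fin; lra.
  apply: ge_ereal_sup => _ /= [_ [l pl <-] <-]; rewrite lee_fin.
  have [l' [cl ll <-]] := chain_partition f pl.
  have ctl : chain lo (t ++ l') p.2 by apply: chain_cat cl; exact: chain_widen ct.
  have := IH p.2 (t ++ l') ctl cs.
  rewrite chain_var_cat chain_len_cat ll -addrA => /(_ td).
  by rewrite -EFinD lee_fin; lra.
- by move=> _ _; rewrite addey.
Qed.

(** Cut the interval into [n.+1] equal pieces shorter than the [d] that belongs to the bound 1. Each
    piece has variation at most 1, and total variation is additive. *)
Lemma chain_abs_cont_bv : (TV lo hi f < +oo)%E.
Proof.
have [d d0 H] := chain_abs_cont_tv ltr01.
pose n := Num.truncn ((hi - lo) / d).
pose h := (hi - lo) / n.+1%:R.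
have h0 : 0 <= h by rewrite divr_ge0// subr_ge0.
have hd : h < d.
  rewrite ltr_pdivrMr// mulrC -ltr_pdivrMr//.
  exact: truncnS_gt.
have xE : lo + n.+1%:R * h = hi by rewrite mulrC divfK// addrC subrK.
suff K k : (k <= n.+1)%N -> (TV lo (lo + k%:R * h) f < +oo)%E.
  by have := K n.+1 (leqnn _); rewrite xE.
elim: k => [|k IH] kn; first by rewrite mul0r addr0 total_variationxx ltry.
have kk : lo + k%:R * h <= lo + k.+1%:R * h.
  by rewrite lerD2l ler_wpM2r// ler_nat.
have lk : lo <= lo + k%:R * h by rewrite lerDl mulr_ge0.
rewrite (total_variationD f lk kk) lte_add_pinfty//; first exact/IH/ltnW.
apply: le_lt_trans (ltry 1).
have := H [:: (lo + k%:R * h, lo + k.+1%:R * h)].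
rewrite /chain_len !big_seq1 /=; apply.
  by rewrite lk kk -[X in _ <= X]xE lerD2l ler_wpM2r// ler_nat.
by rewrite opprD addrACA subrr add0r -mulrBl -natrB ?leqnSn// subSnn mul1r.
Qed.

Let V x := fine (TV lo x f).

Let TV_fin x y : lo <= x -> x <= y -> y <= hi -> TV x y f \is a fin_num.
Proof.
move=> lx xy yh; rewrite ge0_fin_numE ?total_variation_ge0//.
apply: le_lt_trans chain_abs_cont_bv.
rewrite (total_variationD f lx (le_trans xy yh)) (total_variationD f xy yh).
by rewrite addeCA leeDl// adde_ge0// total_variation_ge0.
Qed.

Let VB x y : lo <= x -> x <= y -> y <= hi -> (V y - V x)%:E = TV x y f.
Proof.
move=> lx xy yh; rewrite /V (total_variationD f lx xy).
have f1 : TV lo x f \is a fin_num by rewrite TV_fin// (le_trans xy).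
have f2 := TV_fin lx xy yh.
by rewrite fineD// addrC addKr fineK.
Qed.

Let V_le x y : lo <= x -> x <= y -> y <= hi -> `|f y - f x| <= V y - V x.
Proof.
by move=> lx xy yh; rewrite -lee_fin VB// total_variation_ge.
Qed.

Lemma chain_memP s p : chain lo s hi -> p \in s ->
  [/\ lo <= p.1, p.1 <= p.2 & p.2 <= hi].
Proof. by move=> cs /(nthP (lo, lo))[i si <-]; exact: chain_nth. Qed.

Let V_ac : chain_abs_cont lo hi V.
Proof.
(* Halving [e] recovers a strict inequality from the non-strict one. *)
move=> e e0; have [|d d0 H] := @chain_abs_cont_tv (e / 2); first exact: divr_gt0.
exists d => // s cs /(H _ cs) h.
suff : chain_var V s <= e / 2 by lra.
rewrite -lee_fin; apply: le_trans h.
rewrite /chain_var -sumEFin big_seq [leRHS]big_seq; apply: lee_sum => p ps.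
have [h1 h2 h3] := chain_memP cs ps.
by rewrite -VB// lee_fin ger0_norm// (le_trans _ (V_le h1 h2 h3)).
Qed.

Lemma chain_abs_cont_le (F G : R -> R) (c : R) :
  (forall x y, lo <= x -> x <= y -> y <= hi -> `|G y - G x| <= c * `|F y - F x|) ->
  0 < c -> chain_abs_cont lo hi F -> chain_abs_cont lo hi G.
Proof.
move=> FG c0 acF e e0; have [|d d0 H] := acF (e / c); first exact: divr_gt0.
exists d => // s cs /(H _ cs).
rewrite ltr_pdivlMr//; apply: le_lt_trans.
rewrite /chain_var mulr_suml big_seq [leRHS]big_seq; apply: ler_sum => p ps.
by have [h1 h2 h3] := chain_memP cs ps; rewrite mulrC FG.
Qed.

Lemma abs_cont_decomposition : exists F G : R -> R,
  [/\ f = F \- G, chain_abs_cont lo hi F, chain_abs_cont lo hi G,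
   {in `[lo, hi] &, nondecreasing_fun F} & {in `[lo, hi] &, nondecreasing_fun G}].
Proof.
exists V, (V \- f); split=> //.
- by apply/funext => x /=; rewrite subKr.
(* Increments of [f] are bounded by those of [V], so those of [V \- f] are at most twice as
   large. *)
- apply: (@chain_abs_cont_le V _ 2) => // x y lx xy yh /=.
  have := V_le lx xy yh; rewrite [`|V y - V x|]ger0_norm; last first.
    exact: le_trans (V_le lx xy yh).
  by rewrite !ler_norml => /andP[h1 h2]; apply/andP; split; lra.
- move=> x y; rewrite !in_itv/= => /andP[lx _] /andP[_ yh] xy.
  by rewrite -subr_ge0 (le_trans _ (V_le lx xy yh)).
- move=> x y; rewrite !in_itv/= => /andP[lx _] /andP[_ yh] xy /=.
  by have := V_le lx xy yh; rewrite ler_norml => /andP[h1 h2]; lra.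
Qed.
End AbsContBV.

(** * Almost everywhere derivability *)

Section MonotoneAbsCont.
Context {R : realType}.
Local Notation mu := (@lebesgue_measure R).
Variables (lo hi : R) (F : R -> R).
Hypotheses (lohi : lo < hi) (acF : chain_abs_cont lo hi F).
Hypothesis ndF : {in `[lo, hi] &, nondecreasing_fun F}.

Let clamp x : R := Num.max lo (Num.min x hi).

Let clamp_itv x : lo <= clamp x <= hi.
Proof.
have lh := ltW lohi; rewrite /clamp.
case: (leP x hi) => ?; rewrite ?(max_r lh) ?lh ?lexx//.
by case: (leP lo x) => ?; lra.
Qed.

Let clamp_mono x y : x <= y -> 0 <= clamp y - clamp x <= y - x.
Proof.
rewrite /clamp => xy; have lh := ltW lohi.
by case: (leP x hi) => ?; case: (leP y hi) => ?; rewrite ?(max_r lh);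
  case: (leP lo x) => ?; case: (leP lo y) => ?; lra.
Qed.

Let clampE x : lo <= x <= hi -> clamp x = x.
Proof.
by rewrite /clamp => /andP[lx xh]; rewrite min_l// max_r.
Qed.

(** Constant extension of [F] beyond the interval: a Stieltjes measure needs a function that is
    monotone and right-continuous on the whole line. *)
Let G x := F (clamp x).

Let G_nd : {homo G : x y / x <= y}.
Proof.
move=> x y /clamp_mono /andP[xy _]; apply: ndF; rewrite ?in_itv/= ?clamp_itv//.
by rewrite -subr_ge0.
Qed.

Let G_rc : forall x, G @ x^'+ --> G x.
Proof.
move=> x; apply/cvgrPdist_lt => e e0; have [d d0 H] := acF e0.
near=> y; have xy : x < y by near: y; exact: nbhs_right_gt.
have yd : y < x + d by near: y; apply: nbhs_right_lt; rewrite ltrDl.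
have /andP[c0 c1] := clamp_mono (ltW xy).
have := H [:: (clamp x, clamp y)].
rewrite /chain_len /chain_var !big_seq1/= distrC; apply.
  have /andP[-> _] := clamp_itv x; have /andP[_ ->] := clamp_itv y.
  by rewrite -subr_ge0 c0.
by lra.
Unshelve. all: by end_near. Qed.

HB.instance Definition _ := isCumulative.Build R _ R G G_nd G_rc.

Let nu : {measure set (measurableTypeR R) -> \bar R} :=
  lebesgue_stieltjes_measure G.

Let nu_oc a b : a <= b -> nu `]a, b]%classic = (G b - G a)%:E.
Proof.
move=> ab; rewrite /nu /= /lebesgue_stieltjes_measure /measure_extension.
by rewrite measurable_mu_extE/=; [rewrite wlength_itv_bnd|exact: is_ocitv].
Qed.

(** Half-open, so that the half-open cells of a grid tile it exactly and [nu_oc] measures it. *)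
Let D : set (measurableTypeR R) := `]lo, hi]%classic.

Let mD : measurable D. Proof. exact: measurable_itv. Qed.

Let nuD : (nu D < +oo)%E. Proof. by rewrite nu_oc ?ltry// ltW. Qed.

Let rnu : {finite_measure set (measurableTypeR R) -> \bar R} := mfrestr mD nuD.

(** * Comparison of [nu] with Lebesgue measure on a uniform grid *)

Section Grid.
Variable n : nat.
Let h := (hi - lo) / n.+1%:R.
Let x_ (j : nat) := lo + j%:R * h.
Let cell j : set R := `]x_ j, x_ j.+1]%classic.

Let h_gt0 : 0 < h. Proof. by rewrite divr_gt0// subr_gt0. Qed.

Let x_0 : x_ 0 = lo. Proof. by rewrite /x_ mul0r addr0. Qed.

Let x_n : x_ n.+1 = hi. Proof. by rewrite /x_ mulrC divfK// addrC subrK. Qed.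

Let x_S j : x_ j.+1 = x_ j + h. Proof. by rewrite /x_ -natr1 mulrDl mul1r addrA. Qed.

Let x_le i j : (i <= j)%N -> x_ i <= x_ j.
Proof. by move=> ij; rewrite lerD2l ler_wpM2r ?ler_nat// ltW. Qed.

Let x_lt i j : x_ i < x_ j -> (i < j)%N.
Proof. by rewrite ltNge; apply: contraNT; rewrite -leqNgt; exact: x_le. Qed.

Let D_cell z : D z -> exists j : 'I_n.+1, cell j z.
Proof.
rewrite /D/= in_itv/= => /andP[lz zh].
have ex : exists k, z <= x_ k by exists n.+1; rewrite x_n.
(* The least grid point that is at least [z] closes the cell of [z]; its index is positive since
   [lo < z]. *)
case: (ex_minnP ex) => -[|j] zj jmin; first by move: zj; rewrite x_0 leNgt lz.
have jn : (j < n.+1)%N by apply: jmin; rewrite x_n.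
exists (Ordinal jn); rewrite /cell/= in_itv/= zj andbT ltNge; apply/negP => /jmin.
by rewrite ltnn.
Qed.

Let cell_triv (P : set 'I_n.+1) : trivIset P (fun j : 'I_n.+1 => cell j).
Proof.
move=> i j _ _ [z []]; rewrite /cell/= !in_itv/= => /andP[iz zi] /andP[jz zj].
apply/val_inj/anti_leq/andP; split; rewrite -ltnS; apply: x_lt.
  exact: lt_le_trans zj.
exact: lt_le_trans zi.
Qed.

(* Unselected cells contribute degenerate intervals, which keeps the chain indexed
   by all the cells. *)
Let cells_chain (P : pred nat) i k :
  chain (x_ i) [seq (x_ j, if P j then x_ j.+1 else x_ j) | j <- iota i k]
    (x_ (i + k)).
Proof.
elim: k i => [|k IH] i /=; first by rewrite addn0.
rewrite lexx/=; case: ifP => _; first by rewrite x_le//= -addSnnS IH.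
rewrite lexx/=; apply: (@chain_widen _ (x_ i.+1) _ _ (x_ (i.+1 + k))).
- exact: x_le.
- by rewrite addSnnS.
- exact: IH.
Qed.

Let cell_lo j : lo <= x_ j. Proof. by rewrite -x_0 x_le. Qed.

(** Cells have width [h], so each cell meeting [A] lies in [U]. The cells contained in [U] thus
    cover [A] and have total length below [d]; the increments of [F] over them, which add up to
    their [nu]-measure, are then bounded by [e]. *)
Lemma grid_nu_le (e d : R) (U A : set R) :
  (forall s, chain lo s hi -> chain_len s < d -> chain_var F s < e) ->
  measurable U -> (mu U < d%:E)%E -> measurable A -> A `<=` D ->
  (forall z w, A z -> `|z - w| <= h -> U w) -> (nu A <= e%:E)%E.
Proof.
move=> H mU Ud mA AD AU.
pose P (j : nat) := `[< cell j `<=` U >].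
pose C := \big[setU/set0]_(j < n.+1 | P j) cell j.
have mcell (j : 'I_n.+1) : measurable (cell j) by exact: measurable_itv.
have mC : measurable C by apply: bigsetU_measurable => j _.
have AC : A `<=` C.
  move=> z Az; have [j jz] := D_cell (AD _ Az); rewrite /C -bigcup_seq_cond.
  exists j => //=; rewrite mem_index_enum; apply/asboolP => w.
  move: jz; rewrite /cell/= !in_itv/= x_S => /andP[h1 h2] /andP[h3 h4].
  by apply: (AU z w) => //; rewrite ler_norml; apply/andP; split; lra.
have CU : C `<=` U.
  rewrite /C -bigcup_seq_cond => z [j /= /andP[_ /asboolP]]; exact.
pose s := [seq (x_ j, if P j then x_ j.+1 else x_ j) | j <- iota 0 n.+1].
have cs : chain lo s hi by have := cells_chain P 0 n.+1; rewrite x_0 add0n x_n.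
have lenE : (chain_len s)%:E = mu C.
  rewrite /C measure_bigsetU_ord_cond; last 2 first.
  - by move=> j _; exact: mcell.
  - exact: cell_triv.
  rewrite /chain_len /s big_map -[iota _ _]/(index_iota 0 n.+1) big_mkord.
  rewrite -sumEFin [RHS]big_mkcond; apply: eq_bigr => j _ /=; case: ifP => _.
    by rewrite /cell lebesgue_measure_itv/= lte_fin x_S ltrDl h_gt0 EFinB.
  by rewrite subrr.
(* Monotonicity of [F] removes the absolute values, leaving the increments that [nu] assigns to the
   cells. *)
have varE : (chain_var F s)%:E = nu C.
  rewrite /C measure_bigsetU_ord_cond; last 2 first.
  - by move=> j _; exact: mcell.
  - exact: cell_triv.
  rewrite /chain_var /s big_map -[iota _ _]/(index_iota 0 n.+1) big_mkord.
  rewrite -sumEFin [RHS]big_mkcond; apply: eq_bigr => j _ /=; case: ifP => _.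
    have xx : x_ j <= x_ j.+1 by exact: x_le.
    have xh : x_ j.+1 <= hi by rewrite -x_n x_le.
    rewrite nu_oc// /G !clampE ?cell_lo//= ?(le_trans xx)// ger0_norm//.
    by rewrite subr_ge0; apply: ndF => //; rewrite in_itv/= cell_lo//= (le_trans xx).
  by rewrite subrr normr0.
apply: (@le_trans _ _ (nu C)); first by apply: le_measure; rewrite ?inE.
rewrite -varE lee_fin ltW//; apply: H => //.
rewrite -lte_fin lenE; apply: le_lt_trans Ud.
by apply: le_measure; rewrite ?inE.
Qed.
End Grid.

(** Absolute continuity only sees finitely many intervals; open sets are reached by continuity of
    [nu] from below, with a [d] independent of [U]. *)
Let nu_open (e : R) : 0 < e -> exists2 d : R, 0 < d &
  forall U, open U -> (mu U < d%:E)%E -> (nu (U `&` D) <= e%:E)%E.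
Proof.
move=> e0; have [d d0 H] := acF e0; exists d => // U oU Ud.
(* The points at distance at least 1/(m+1) from the complement of U are covered by
   the cells contained in U of any finer grid. *)
pose W (m : nat) := D `&` ~` (\bigcup_(y in ~` U) ball y m.+1%:R^-1).
have mW m : measurable (W m).
  apply: measurableI => //; apply: measurableC; apply: open_measurable.
  by apply: bigcup_open => y _; exact: ball_open.
have WE : U `&` D = \bigcup_m W m.
  apply/seteqP; split => [z [Uz Dz]|z [m _ [Dz nz]]]; last first.
    split=> //; apply: contrapT => Uz; apply: nz; exists z => //.
    exact: ballxx.
  have /nbhs_ballP[r /= r0 rU] := open_nbhs_nbhs (conj oU Uz).
  exists (Num.truncn r^-1) => //; split => // -[y yU zy]; apply/yU/rU.
  rewrite -ball_normE/= distrC; move: zy; rewrite -ball_normE/= => zy.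
  apply: lt_trans zy _; rewrite invf_plt ?posrE//.
  exact: truncnS_gt.
have ndW : nondecreasing_seq W.
  move=> i j ij; apply/subsetPset => z [Dz nz]; split => // -[y yU zy]; apply: nz.
  exists y => //; apply: le_ball zy.
  by rewrite lef_pV2 ?posrE// ler_nat.
have cv : nu (W m) @[m --> \oo] --> nu (\bigcup_m W m).
  apply: nondecreasing_cvg_mu => //; exact: bigcup_measurable.
rewrite WE -(cvg_lim _ cv)//; apply: lime_le.
  by apply/cvg_ex; eexists; exact: cv.
apply: nearW => m.
(* With this number of cells the mesh is smaller than 1/(m+1), the distance that defines [W m]. *)
apply: (@grid_nu_le (Num.truncn ((hi - lo) * m.+1%:R)) e d U) => //.
- exact: open_measurable.
- exact: mW.
- by move=> z [].
- move=> z w [_ nz] zw; apply: contrapT => Uw; apply: nz; exists w => //.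
  rewrite -ball_normE/= distrC; apply: le_lt_trans zw _.
  rewrite ltr_pdivrMr// mulrC -ltr_pdivrMr ?invr_gt0// invrK.
  exact: truncnS_gt.
Qed.

(** By outer regularity a null set lies in open sets of arbitrarily small measure, to which
    [nu_open] applies. *)
Let rnu_dom : rnu `<< mu.
Proof.
apply/null_content_dominatesP => N mN N0; apply/eqP.
rewrite -measure_le0; apply/lee_addgt0Pr => e e0; rewrite add0e.
have [d d0 H] := nu_open e0.
have [|U [oU NU Ud]] := @lebesgue_regularity_outer _ N d mN _ d0.
  by rewrite N0.
have mU := open_measurable oU.
apply: (@le_trans _ _ (nu (U `&` D))); last first.
  apply: H => //; move: Ud; rewrite (measureDI mu mU mN) setIidr//.
  by rewrite [X in (_ + X)%E]N0 adde0.
have mND : measurable (N `&` D) := measurableI _ _ mN mD.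
have mUD : measurable (U `&` D) := measurableI _ _ mU mD.
by apply: le_measure; rewrite ?inE//; exact: setSI.
Qed.

Lemma nondecreasing_abs_cont_derivable :
  {ae mu, forall x, lo < x < hi -> derivable F x 1}.
Proof.
have [g [g0 gfin ig gE]] := radon_nikodym_sigma_finite rnu_dom.
pose f x := fine (g x).
have fg : EFin \o f = g by apply/funext => x; rewrite /f/= fineK.
have fT : mu.-integrable setT (EFin \o f) by rewrite fg.
have locf : locally_integrable [set: R] f.
  by have := integrable_locally measurableT fT; rewrite patch_setT.
have := FTC1Ny _ locf.
have fy (y : R) : mu.-integrable `]-oo, y] (EFin \o f).
  by apply: integrableS fT.
move=> /(_ fy); apply: filterS; first exact: (ae_filter_ringOfSetsType mu).
move=> x [dx _] /andP[lx xh].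
(* Since [rnu] is carried by [D], the integral of its density up to [y] is [nu] of ]lo, y], that is,
   the increment of [F] from [lo] to [y]. *)
have FE y : lo < y < hi -> F lo + \int[mu]_(t in `]-oo, y]) f t = F y.
  move=> /andP[ly yh]; have lh := ltW lohi; rewrite /Rintegral.
  have -> : (\int[mu]_(t in `]-oo, y]) (f t)%:E = rnu `]-oo, y]%classic)%E.
    rewrite gE//; by apply: eq_integral => t _; rewrite -fg.
  rewrite /rnu/= /mfrestr/= /mrestr.
  have -> : `]-oo, y]%classic `&` D = `]lo, y]%classic.
    apply/seteqP; split => z; rewrite /D/= !in_itv/=; first by move=> [-> /andP[->]].
    by move=> /andP[h1 h2]; rewrite h1 h2 (le_trans h2)// ltW.
  rewrite nu_oc ?ltW//= /G !clampE ?lexx ?lh//=; last by rewrite (ltW ly) ltW.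
  by rewrite addrC subrK.
have dPhi : derivable (fun y : R => F lo + \int[mu]_(t in `]-oo, y]) f t) x 1.
  by apply: derivableD => //; exact: derivable_cst.
apply: near_eq_derivable dPhi; near=> y; apply: FE; apply/andP; split; near: y.
  exact: lt_nbhsr.
exact: lt_nbhsl.
Unshelve. all: by end_near. Qed.
End MonotoneAbsCont.

(** * Derivability of absolutely continuous functions, and their stability under combinations and
    changes of variable *)

Section AbsContClosure.
Context {R : realType}.
Local Notation mu := (@lebesgue_measure R).
Implicit Types (lo hi c : R) (f g : R -> R).

Lemma abs_cont_derivable lo hi f : lo < hi -> abs_cont_on lo hi f ->
  {ae mu, forall x, lo < x < hi -> derivable f x 1}.
Proof.
move=> lohi /abs_cont_on_chain acf.
have [F [G [-> acF acG ndF ndG]]] := abs_cont_decomposition (ltW lohi) acf.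
have aF := nondecreasing_abs_cont_derivable lohi acF ndF.
have aG := nondecreasing_abs_cont_derivable lohi acG ndG.
move: aF aG; apply: filterS2; first exact: (ae_filter_ringOfSetsType mu).
by move=> x dF dG xlh; apply: derivableB; [exact: dF|exact: dG].
Qed.

Lemma abs_cont_on_cst lo hi c : abs_cont_on lo hi (cst c).
Proof.
move=> e e0; exists 1 => // k x y _ _ _.
by under eq_bigr do rewrite subrr normr0; rewrite big1.
Qed.

Lemma abs_cont_on_lin lo hi c f g : abs_cont_on lo hi f ->
  abs_cont_on lo hi g -> abs_cont_on lo hi (fun t => f t + c * g t).
Proof.
move=> acf acg e e0.
have c0 : 0 < 1 + `|c| by rewrite ltr_wpDr.
have [|d1 d10 H1] := acf (e / 2); first exact: divr_gt0.
(* The added 1 keeps the divisor positive when [c] is zero. *)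
have [|d2 d20 H2] := acg (e / 2 / (1 + `|c|)); first by rewrite !divr_gt0.
exists (Num.min d1 d2) => [|k x y xy ord]; first by rewrite lt_min d10.
rewrite lt_min => /andP[/(H1 _ _ _ xy ord) h1 /(H2 _ _ _ xy ord)].
rewrite ltr_pdivlMr// => h2.
apply: (@le_lt_trans _ _ (\sum_(i < k) `|f (y i) - f (x i)| +
   (\sum_(i < k) `|g (y i) - g (x i)|) * (1 + `|c|))); last by lra.
rewrite mulr_suml -big_split/=; apply: ler_sum => i _.
rewrite opprD addrACA -mulrBr (le_trans (ler_normD _ _))// lerD2l normrM mulrC.
by rewrite ler_wpM2l// lerDr.
Qed.

Lemma abs_cont_on_comp_nd lo hi lo' hi' f (phi : R -> R) :
  abs_cont_on lo hi f -> {in `[lo', hi'], forall x, lo <= phi x <= hi} ->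
  (forall x y, x <= y -> 0 <= phi y - phi x <= y - x) ->
  abs_cont_on lo' hi' (f \o phi).
Proof.
move=> acf phi_itv phiB e e0; have [d d0 H] := acf e e0.
exists d => // k x y xy ord xyd; apply: (H k (phi \o x) (phi \o y)).
- move=> i; have [h1 [h2 h3]] := xy i; have := phiB _ _ h2.
  rewrite subr_ge0 => /andP[-> _] /=.
  have /phi_itv/andP[-> _] : x i \in `[lo', hi'].
    by rewrite in_itv/= h1 (le_trans h2).
  have /phi_itv/andP[_ ->] // : y i \in `[lo', hi'].
  by rewrite in_itv/= h3 (le_trans h1).
- by move=> i j /ord /phiB; rewrite subr_ge0 => /andP[].
- apply: le_lt_trans xyd; apply: ler_sum => i _ /=.
  by have [_ [/phiB/andP[]]] := xy i.
Qed.

Lemma abs_cont_on_comp_ni lo hi lo' hi' f (phi : R -> R) :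
  abs_cont_on lo hi f -> {in `[lo', hi'], forall x, lo <= phi x <= hi} ->
  (forall x y, x <= y -> 0 <= phi x - phi y <= y - x) ->
  abs_cont_on lo' hi' (f \o phi).
Proof.
move=> acf phi_itv phiB e e0; have [d d0 H] := acf e e0.
exists d => // k x y xy ord xyd.
(* A nonincreasing map reverses the order of the intervals and swaps their endpoints. *)
rewrite (reindex_inj rev_ord_inj)/=; under eq_bigr do rewrite distrC.
apply: (H k (phi \o y \o @rev_ord k) (phi \o x \o @rev_ord k)).
- move=> j; set i := rev_ord j; have [h1 [h2 h3]] := xy i; have := phiB _ _ h2.
  rewrite subr_ge0 => /andP[-> _] /=.
  have /phi_itv/andP[_ ->] : x i \in `[lo', hi'].
    by rewrite in_itv/= h1 (le_trans h2).
  have /phi_itv/andP[-> _] // : y i \in `[lo', hi'].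
  by rewrite in_itv/= h3 (le_trans h1).
- move=> i j ij; have : (rev_ord j < rev_ord i)%N.
    by rewrite /= ltn_sub2l// (leq_ltn_trans _ (ltn_ord j)).
  by move=> /ord /phiB; rewrite subr_ge0 => /andP[].
- apply: le_lt_trans xyd; rewrite [leRHS](reindex_inj rev_ord_inj)/=.
  by apply: ler_sum => j _ /=; have [_ [/phiB/andP[]]] := xy (rev_ord j).
Qed.

End AbsContClosure.

(** * Reflection *)

Section ReflectExt.
Context {R : realType}.
Local Notation mu := (@lebesgue_measure R).
Implicit Types (c t T d : R) (p : R -> R).

(** The even reflection is [c = 1], the odd one [c = -1]. Keeping [c] general treats the solutions,
    their derivatives of alternating parity and the right-hand sides alike. *)
Definition reflect_ext c T p t : R := if t <= T then p t else c * p (2 * T - t).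

(** In Caratheodory's form of the derivative, the two slope functions are continuous at [T] with the
    same value, so their gluing is continuous there too. *)
Lemma is_derive_glue (f g : R -> R) T d : f T = g T ->
  is_derive T 1 f d -> is_derive T 1 g d ->
  is_derive T 1 (fun t => if t <= T then f t else g t) d.
Proof.
move=> fg /is_derive1_caratheodory[f1 [f1E cf1 f1T]].
move=> /is_derive1_caratheodory[g1 [g1E cg1 g1T]].
apply/is_derive1_caratheodory; exists (fun t => if t <= T then f1 t else g1 t).
rewrite lexx; split=> //.
  by move=> z; case: ifP => _; [rewrite f1E|rewrite fg g1E].
apply/cvgrPdist_lt => e e0; rewrite lexx.
have /cvgrPdist_lt/(_ e e0) hf := cf1.
have /cvgrPdist_lt/(_ e e0) hg := cg1.
near=> t; case: ifP => _; first by near: t; exact: hf.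
by rewrite f1T -g1T; near: t; exact: hg.
Unshelve. all: by end_near. Qed.

Lemma is_derive_reflect c T t p d : is_derive (2 * T - t) 1 p d ->
  is_derive t 1 (fun t => c * p (2 * T - t)) (- c * d).
Proof.
move=> dp.
have h : is_derive t 1 (fun t => 2 * T - t : R) (0 - 1).
  exact: is_deriveB.
have := is_deriveZ c (@is_derive1_comp R p (fun t => 2 * T - t) t d (0 - 1) dp h).
by rewrite sub0r mulrN1 scalerN -scaleNr.
Qed.

Lemma is_derive_reflect_ext_lt c T p t : t < T -> derivable p t 1 ->
  is_derive t 1 (reflect_ext c T p) (derive1 p t).
Proof.
move=> tT dp; apply: (@near_eq_is_derive _ _ _ p).
  near=> s; rewrite /reflect_ext ifT//; apply: ltW; near: s; exact: lt_nbhsl.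
by rewrite derive1E; exact: derivableP.
Unshelve. all: by end_near. Qed.

Lemma is_derive_reflect_ext_gt c T p t : T < t -> derivable p (2 * T - t) 1 ->
  is_derive t 1 (reflect_ext c T p) (- c * derive1 p (2 * T - t)).
Proof.
move=> tT dp; apply: (@near_eq_is_derive _ _ _ (fun t => c * p (2 * T - t))).
  near=> s; rewrite /reflect_ext ifF//; apply/negbTE; rewrite -ltNge.
  by near: s; exact: lt_nbhsr.
apply: is_derive_reflect; rewrite derive1E; exact: derivableP.
Unshelve. all: by end_near. Qed.

Lemma is_derive_reflect_ext c T p t : (forall t, derivable p t 1) ->
  p T = c * p T -> derive1 p T = - c * derive1 p T ->
  is_derive t 1 (reflect_ext c T p) (reflect_ext (- c) T (derive1 p) t).
Proof.
move=> dp pT dpT.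
have [tT|Tt|->] := ltgtP t T.
- by rewrite {2}/reflect_ext ltW//; exact: is_derive_reflect_ext_lt.
- by rewrite {2}/reflect_ext leNgt Tt/=; exact: is_derive_reflect_ext_gt.
- have TT : 2 * T - T = T by ring.
  rewrite {2}/reflect_ext lexx; apply: is_derive_glue.
  + by rewrite TT.
  + by rewrite derive1E; exact: derivableP.
  + rewrite dpT; apply: is_derive_reflect; rewrite TT derive1E; exact: derivableP.
Qed.

(** On either side of [T] one of the two compositions is frozen at [p T], which the last term
    cancels. Without a case distinction, continuity and absolute continuity follow from composition
    and linear combination. *)
Lemma reflect_extE c T p : p T = c * p T -> reflect_ext c T p =
  (fun t => (p \o (Num.min^~ T)) t +
    c * (p \o (fun t => 2 * T - Num.max t T)) t + -1 * p T).
Proof.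
move=> pT; apply/funext => t; rewrite /reflect_ext /=; case: leP => tT.
  by rewrite mulrDl mul1r addrK -pT; lra.
by lra.
Qed.

Lemma continuous_reflect_ext c T p : continuous p -> p T = c * p T ->
  continuous (reflect_ext c T p).
Proof.
move=> cp pT t; rewrite reflect_extE//.
have h1 : {for t, continuous (p \o (Num.min^~ T))}.
  apply: continuous_comp; last exact: cp.
  by apply: (@continuous_min R R id (cst T)) => //; exact: cst_continuous.
have h2 : {for t, continuous (p \o (fun t => 2 * T - Num.max t T))}.
  apply: continuous_comp; last exact: cp.
  apply: cvgB; first exact: cvg_cst.
  by apply: (@continuous_max R R id (cst T)) => //; exact: cst_continuous.
apply: cvgD; last exact: cvg_cst.
apply: cvgD; first exact: h1.
by apply: cvgM; [exact: cvg_cst|exact: h2].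
Qed.

Lemma abs_cont_reflect_ext c T p : 0 < T -> abs_cont_on 0 T p -> p T = c * p T ->
  abs_cont_on 0 (2 * T) (reflect_ext c T p).
Proof.
move=> T0 acp pT; rewrite reflect_extE//.
apply: abs_cont_on_lin; last exact: abs_cont_on_cst.
apply: abs_cont_on_lin.
  apply: abs_cont_on_comp_nd acp _ _.
    by move=> x; rewrite in_itv/= => /andP[x0 x2]; case: (leP x T) => ?; lra.
  by move=> x y xy; case: (leP x T) => ?; case: (leP y T) => ?; lra.
apply: abs_cont_on_comp_ni acp _ _.
  by move=> x; rewrite in_itv/= => /andP[x0 x2]; case: (leP x T) => ?; lra.
by move=> x y xy; case: (leP x T) => ?; case: (leP y T) => ?; lra.
Qed.

End ReflectExt.

(** * Linear combinations and reflections in the periodic space *)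

Section XPClosure.
Context {R : realType}.
Local Notation mu := (@lebesgue_measure R).
Implicit Types (c t T lo hi : R) (u v : R -> R) (n : nat) (a : nat -> R -> R).

Lemma ae_itv_oo_cc lo hi (P : R -> Prop) :
  {ae mu, forall t, lo < t < hi -> P t} ->
  {ae mu, forall t, `[lo, hi]%classic t -> P t}.
Proof.
move=> aP.
have neq (x : R) : {ae mu, forall t : R, t != x}.
  exists [set x]; split; [exact: measurable_set1|exact: lebesgue_measure_set1|].
  by move=> t /= /negP; rewrite negbK => /eqP.
move: aP (neq lo) (neq hi); apply: filterS3; first exact: (ae_filter_ringOfSetsType mu).
move=> t Pt tlo thi; rewrite /= in_itv/= => /andP[h1 h2]; apply: Pt.
by rewrite !lt_neqAle h1 h2 thi eq_sym tlo.
Qed.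

Lemma is_derive_lin c f g t : derivable f t 1 -> derivable g t 1 ->
  is_derive t 1 (fun t => f t + c * g t : R) (derive1 f t + c * derive1 g t).
Proof.
move=> df dg; rewrite !derive1E; apply: is_deriveD; first exact: derivableP.
by apply: is_deriveZ; exact: derivableP.
Qed.

Section Linear.
Variables (m : nat) (c : R) (u v : R -> R).
Hypothesis du : forall k, (k < m)%N -> forall t, derivable (derive1n k u) t 1.
Hypothesis dv : forall k, (k < m)%N -> forall t, derivable (derive1n k v) t 1.

Lemma derive1n_lin k : (k <= m)%N -> derive1n k (fun t => u t + c * v t) =
  (fun t => derive1n k u t + c * derive1n k v t).
Proof.
elim: k => [|k IH] km; first by rewrite !derive1n0.
rewrite derive1nS.
rewrite (IH (ltnW km)).
apply/funext => t.
have [_ dE] := is_derive_lin c (@du k km t) (@dv k km t).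
by rewrite derive1E dE -!derive1nS.
Qed.
End Linear.

Lemma W2n1_lin n lo hi c u v : W2n1 n lo hi u -> W2n1 n lo hi v ->
  W2n1 n lo hi (fun t => u t + c * v t).
Proof.
move=> [du [cu au]] [dv [cv av]]; split; [|split].
- move=> k km t; rewrite (derive1n_lin c du dv (ltnW km)).
  by have [] := is_derive_lin c (du k km t) (dv k km t).
- rewrite (derive1n_lin c du dv (leqnn _)) => t.
  by apply: cvgD; [exact: cu|apply: cvgM; [exact: cvg_cst|exact: cv]].
- by rewrite (derive1n_lin c du dv (leqnn _)); exact: abs_cont_on_lin.
Qed.

Lemma XP_lin n T c u v : (0 < n)%N -> XP n T u -> XP n T v ->
  XP n T (fun t => u t + c * v t).
Proof.
move=> n0 [[du Wu] Pu] [[dv Wv] Pv]; split; first exact: W2n1_lin.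
move=> k kn; have km : (k <= (2 * n).-1)%N by rewrite -ltnS prednK// muln_gt0.
by rewrite (derive1n_lin c du dv km) Pu// Pv.
Qed.

Lemma W2n1_ae_derivable n lo hi u : lo < hi -> W2n1 n lo hi u ->
  {ae mu, forall t, lo < t < hi -> derivable (derive1n (2 * n).-1 u) t 1}.
Proof. by move=> lohi [_ [_ ac]]; exact: abs_cont_derivable. Qed.

Lemma Lop_lin n a lo hi c u v : (0 < n)%N -> lo < hi ->
  W2n1 n lo hi u -> W2n1 n lo hi v ->
  {ae mu, forall t, `[lo, hi]%classic t ->
    Lop n a (fun t => u t + c * v t) t = Lop n a u t + c * Lop n a v t}.
Proof.
move=> n0 lohi Wu Wv; apply: ae_itv_oo_cc.
move: (W2n1_ae_derivable lohi Wu) (W2n1_ae_derivable lohi Wv).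
apply: filterS2; first exact: (ae_filter_ringOfSetsType mu).
move=> t dut dvt tlh.
have [du _] := Wu; have [dv _] := Wv.
have n2 : (2 * n)%N = (2 * n).-1.+1 by rewrite prednK// muln_gt0.
have top : derive1n (2 * n) (fun t => u t + c * v t) t =
    derive1n (2 * n) u t + c * derive1n (2 * n) v t.
  rewrite n2 !derive1nS (derive1n_lin c du dv (leqnn _)) derive1E.
  by apply: derive_val; apply: is_derive_lin; [exact: dut|exact: dvt].
rewrite /Lop top mulrDr mulr_sumr addrACA; congr (_ + _).
rewrite -big_split/=; apply: eq_bigr => k _.
have km : (k <= (2 * n).-1)%N by rewrite -ltnS -n2.
by rewrite (derive1n_lin c du dv km) mulrDr [c * (_ * _)]mulrCA.
Qed.

(** Each differentiation changes the sign of the reflection factor; the conditions at [T] for orders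
    [k] and [k.+1] make values and slopes match. *)
Lemma derive1n_reflect_ext m c T u :
  (forall k, (k < m)%N -> forall t, derivable (derive1n k u) t 1) ->
  (forall k, (k <= m)%N -> derive1n k u T = (-1) ^+ k * c * derive1n k u T) ->
  forall k, (k <= m)%N ->
  derive1n k (reflect_ext c T u) = reflect_ext ((-1) ^+ k * c) T (derive1n k u).
Proof.
move=> du uT; elim=> [|k IH] km; first by rewrite expr0 mul1r.
rewrite derive1nS IH 1?ltnW//; apply/funext => t.
rewrite derive1E exprS mulN1r mulNr; apply: derive_val.
apply: is_derive_reflect_ext; first exact: du.
- exact/uT/ltnW.
- by rewrite -derive1nS {1}uT// exprS mulN1r mulNr.
Qed.

Lemma derivable_reflect_ext m c T u :
  (forall k, (k < m)%N -> forall t, derivable (derive1n k u) t 1) ->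
  (forall k, (k <= m)%N -> derive1n k u T = (-1) ^+ k * c * derive1n k u T) ->
  forall k, (k < m)%N ->
  forall t, derivable (derive1n k (reflect_ext c T u)) t 1.
Proof.
move=> du uT k km t; rewrite (derive1n_reflect_ext du uT (ltnW km)).
have [|+ _] // := @is_derive_reflect_ext R ((-1) ^+ k * c) T (derive1n k u) t
  (du k km) (uT k (ltnW km)).
by have := uT k.+1 km; rewrite exprS mulN1r mulNr.
Qed.

(** The conditions at [T] give regularity across the midpoint; those at 0 give periodicity, because
    the endpoint [2 * T] reflects to 0. *)
Lemma reflect_ext_XP n T c u : (0 < n)%N -> 0 < T -> W2n1 n 0 T u ->
  (forall k, (k < 2 * n)%N -> derive1n k u T = (-1) ^+ k * c * derive1n k u T) ->
  (forall k, (k < 2 * n)%N -> derive1n k u 0 = (-1) ^+ k * c * derive1n k u 0) ->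
  XP n (2 * T) (reflect_ext c T u).
Proof.
move=> n0 T0 [du [cu au]] uT u0.
have n2 : (2 * n)%N = (2 * n).-1.+1 by rewrite prednK// muln_gt0.
have uT' k : (k <= (2 * n).-1)%N ->
  derive1n k u T = (-1) ^+ k * c * derive1n k u T.
  by rewrite -ltnS -n2; exact: uT.
have E := derive1n_reflect_ext du uT'.
split; [split; [|split]|].
- exact: derivable_reflect_ext.
- by rewrite E//; apply: continuous_reflect_ext => //; exact: uT'.
- by rewrite E//; apply: abs_cont_reflect_ext => //; exact: uT'.
- move=> k kn; rewrite E; last by rewrite -ltnS -n2.
  rewrite /reflect_ext ltW// ifF; first by rewrite subrr; exact: u0.
  by apply/negbTE; rewrite -ltNge; lra.
Qed.

(** Reflection preserves the length of intervals, so the pushforward of [mu] is [mu] by uniqueness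
    of Lebesgue measure. *)
Lemma lebesgue_measure_reflect c (A : set R) : measurable A ->
  mu ((fun t => c - t) @^-1` A) = mu A.
Proof.
move=> mA.
have mphi : measurable_fun setT
  (fun t : measurableTypeR R => c - t : measurableTypeR R).
  by apply: measurable_funB => //; exact: measurable_cst.
pose phi : {mfun (measurableTypeR R) >-> (measurableTypeR R)} :=
  HB.pack (fun t : measurableTypeR R => c - t : measurableTypeR R)
    (isMeasurableFun.Build _ _ _ _ _ mphi).
have := @lebesgue_measure_unique R (pushforward mu phi) _ A mA.
move=> ->//.
move=> X [[x y] /= _ <-]; rewrite /pushforward.
have -> : phi @^-1` `]x, y] = `[c - y, c - x[%classic.
  by apply/seteqP; split => z; rewrite /phi/= !in_itv/= => /andP[h1 h2];
    apply/andP; split; lra.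
rewrite !lebesgue_measure_itv/= !lte_fin ltrD2l ltrN2; case: ifP => // _.
by rewrite -!EFinB; congr EFin; ring.
Qed.

Lemma ae_reflect c (P : R -> Prop) : {ae mu, forall t, P t} ->
  {ae mu, forall t, P (c - t)}.
Proof.
move=> [N [mN N0 sN]].
have mphi : measurable_fun setT (fun t : R => c - t).
  by apply: measurable_funB => //; exact: measurable_cst.
exists ((fun t => c - t) @^-1` N); split.
- by rewrite -[X in measurable X]setTI; exact: mphi.
- by rewrite lebesgue_measure_reflect.
- by move=> t /= nP; apply: sN.
Qed.

End XPClosure.

(** * The reflected equation *)

Section Green.
Context {R : realType}.
Local Notation mu := (@lebesgue_measure R).
Implicit Types (c t T : R) (u v z : R -> R) (n : nat) (a : nat -> R -> R).

Lemma ae_imply (P Q : R -> Prop) : (forall t, P t -> Q t) ->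
  {ae mu, forall t, P t} -> {ae mu, forall t, Q t}.
Proof.
move=> PQ; apply: filterS; first exact: (ae_filter_ringOfSetsType mu).
exact: PQ.
Qed.

Lemma ae_reflect_double T (P : R -> Prop) :
  {ae mu, forall t, `[0, T]%classic t -> P t} ->
  {ae mu, forall t, `[0, 2 * T]%classic t ->
    if t <= T then P t else P (2 * T - t)}.
Proof.
move=> aP; move: aP (ae_reflect (2 * T) aP).
apply: filterS2; first exact: (ae_filter_ringOfSetsType mu).
move=> t; rewrite /= !in_itv/= => P1 P2 /andP[t0 tT].
by case: leP => h; [apply: P1|apply: P2]; lra.
Qed.

(** Beyond [T] the sign that [aext] puts on odd coefficients cancels the one produced by odd
    derivatives, so [c] factors out of every term. The point [T] is discarded as a null set. *)
Lemma Lop_reflect_ext n a T c u (sigma : R -> R) : (0 < n)%N -> 0 < T ->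
  W2n1 n 0 T u ->
  (forall k, (k < 2 * n)%N -> derive1n k u T = (-1) ^+ k * c * derive1n k u T) ->
  {ae mu, forall t, `[0, T]%classic t -> Lop n a u t = sigma t} ->
  {ae mu, forall t, `[0, 2 * T]%classic t ->
    Lop n (aext T a) (reflect_ext c T u) t = reflect_ext c T sigma t}.
Proof.
move=> n0 T0 Wu uT aL.
have [du _] := Wu.
have n2 : (2 * n)%N = (2 * n).-1.+1 by rewrite prednK// muln_gt0.
have uT' k : (k <= (2 * n).-1)%N ->
  derive1n k u T = (-1) ^+ k * c * derive1n k u T.
  by rewrite -ltnS -n2; exact: uT.
have E := derive1n_reflect_ext du uT'.
have aneT : {ae mu, forall t : R, t != T}.
  exists [set T]; split; [exact: measurable_set1|exact: lebesgue_measure_set1|].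
  by move=> t /= /negP; rewrite negbK => /eqP.
move: (ae_reflect_double (ae_itv_oo_cc (W2n1_ae_derivable T0 Wu)))
  (ae_reflect_double aL) aneT.
apply: filterS3; first exact: (ae_filter_ringOfSetsType mu).
move=> t H1 H2 tT tJ; move: (H1 tJ) (H2 tJ) => {H1 H2}.
have LopE b v x : Lop n b v x = derive1 (derive1n (2 * n).-1 v) x +
    \sum_(k < 2 * n) b k x * derive1n k v x.
  by rewrite /Lop {1}n2 derive1nS.
rewrite !LopE [reflect_ext c T sigma t]/reflect_ext E//.
have Ek (k : 'I_(2 * n)) : (k <= (2 * n).-1)%N by rewrite -ltnS -n2.
case: ltgtP tT => // [tT|Tt] _ dt; rewrite (derive1E (reflect_ext _ _ _)).
  have [_ ->] := is_derive_reflect_ext_lt ((-1) ^+ (2 * n).-1 * c) tT dt.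
  move=> <-; congr (_ + _); apply: eq_bigr => k _.
  by rewrite E// /aext /reflect_ext ltW.
have [_ ->] := is_derive_reflect_ext_gt ((-1) ^+ (2 * n).-1 * c) Tt dt.
(* The leading derivative has even order, so its reflection factor is [c] itself. *)
have -> : - ((-1) ^+ (2 * n).-1 * c) = c.
  by rewrite -mulNr -mulN1r -exprS -n2 exprM sqrrN !expr1n mul1r.
move=> <-; rewrite mulrDr mulr_sumr; congr (_ + _); apply: eq_bigr => k _.
rewrite E// /aext /reflect_ext leNgt Tt/= -signr_odd.
by case: odd; rewrite ?expr0 ?expr1; ring.
Qed.

Lemma integrable_lin (D : set R) c (f g : R -> R) : measurable D ->
  mu.-integrable D (EFin \o f) -> mu.-integrable D (EFin \o g) ->
  mu.-integrable D (EFin \o (fun t => f t + c * g t)).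
Proof.
move=> mD intf intg.
have := @integrableD _ _ _ mu D mD _ _ intf (@integrableZl _ _ _ mu D mD c _ intg).
by apply: eq_integrable => // t _ /=; rewrite EFinD EFinM.
Qed.

Lemma integrable_reflect c (f : R -> R) : mu.-integrable setT (EFin \o f) ->
  mu.-integrable setT (EFin \o (fun t => f (c - t))).
Proof.
have mphi : measurable_fun setT
  (fun t : measurableTypeR R => c - t : measurableTypeR R).
  by apply: measurable_funB => //; exact: measurable_cst.
move=> /integrableP[/measurable_EFinP mf fi]; apply/integrableP; split.
  by apply/measurable_EFinP; exact: measurableT_comp mf mphi.
apply: le_lt_trans fi.
have /= := @ge0_integral_pushforward _ _ (measurableTypeR R)
  (measurableTypeR R) R _ mphi mu setT
  (fun t => `|(f t)%:E|)%E.
rewrite preimage_setT => <- //.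
- rewrite (@eq_measure_integral _ _ _ _ mu)// => A mA _ /=.
  by rewrite /pushforward lebesgue_measure_reflect.
- by do 2!apply: measurableT_comp => //.
Qed.

(** On the doubled interval the extension is [f] cut off to [0, T] plus [c] times the reflection of
    [f] cut off to [0, T[; the half-open cut avoids counting [T] twice. *)
Lemma integrable_reflect_ext c T (f : R -> R) : 0 < T ->
  mu.-integrable `[0, T]%classic (EFin \o f) ->
  mu.-integrable `[0, 2 * T]%classic (EFin \o reflect_ext c T f).
Proof.
move=> T0 intf.
have m1 : measurable (`[0, T]%classic : set R) by exact: measurable_itv.
have m2 : measurable (`[0, T[%classic : set R) by exact: measurable_itv.
have intf2 : mu.-integrable `[0, T[%classic (EFin \o f).
  apply: (@integrableS _ _ _ mu _ _ _ m1 m2 _ intf) => t /=.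
  by rewrite !in_itv/= => /andP[-> /ltW].
have := (@integrable_mkcond _ _ _ mu _ (EFin \o f) m1).1 intf.
have := (@integrable_mkcond _ _ _ mu _ (EFin \o f) m2).1 intf2.
rewrite !restrict_EFin => /(integrable_reflect (2 * T)) int2 int1.
have m3 : measurable (`[0, 2 * T]%classic : set R) by exact: measurable_itv.
have := @integrableS _ _ _ mu _ _ _ measurableT m3 (@subsetT _ _)
  (integrable_lin c measurableT int1 int2).
apply: eq_integrable => // t; rewrite inE/= in_itv/= => /andP[t0 tT].
congr EFin; rewrite /reflect_ext !patchE; case: leP => h.
  rewrite mem_set/=; last by rewrite in_itv/=; lra.
  by rewrite memNset/= ?mulr0 ?addr0//= in_itv/=; lra.
rewrite memNset/=; last by rewrite in_itv/=; lra.
by rewrite mem_set ?add0r//= in_itv/=; lra.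
Qed.

Lemma Lop_XP_lin n b T c z0 z1 (s0 s1 : R -> R) : (0 < n)%N -> 0 < T ->
  XP n T z0 -> XP n T z1 ->
  {ae mu, forall t, `[0, T]%classic t -> Lop n b z0 t = s0 t} ->
  {ae mu, forall t, `[0, T]%classic t -> Lop n b z1 t = s1 t} ->
  {ae mu, forall t, `[0, T]%classic t ->
    Lop n b (fun t => z0 t + c * z1 t) t = s0 t + c * s1 t}.
Proof.
move=> n0 T0 [W0 _] [W1 _]; move: (Lop_lin b c n0 T0 W0 W1).
apply: filterS3; first exact: (ae_filter_ringOfSetsType mu).
by move=> t L L0 L1 tT; rewrite L// L0// L1.
Qed.

(** Nonresonance identifies [z] with the solution represented by [G], whose integrand is pointwise
    nonnegative. *)
Lemma green_fun_ge0 n b T (G : R -> R -> R) z (tau : R -> R) :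
  (0 < n)%N -> 0 < T ->
  green_fun (Lop n b) (XP n T) 0 T G -> XP n T z ->
  {ae mu, forall t, `[0, T]%classic t -> Lop n b z t = tau t} ->
  mu.-integrable `[0, T]%classic (EFin \o tau) ->
  (forall t s, `[0, T]%classic t -> `[0, T]%classic s -> 0 <= G t s * tau s) ->
  forall t, `[0, T]%classic t -> 0 <= z t.
Proof.
move=> n0 T0 [nr ex] Xz Lz itau G0 t tT.
have [u [Xu Lu uE]] := ex _ itau.
have := nr (fun t => z t + -1 * u t) (XP_lin _ n0 Xz Xu).
have L := Lop_XP_lin (-1) n0 T0 Xz Xu Lz Lu.
have L0 : {ae mu, forall t, `[0, T]%classic t ->
    Lop n b (fun t => z t + -1 * u t) t = 0}.
  move: L; apply: filterS; first exact: (ae_filter_ringOfSetsType mu).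
  by move=> x Lx xT; rewrite Lx// mulN1r subrr.
move=> /(_ L0 _ tT); rewrite mulN1r => /subr0_eq ->.
rewrite -lee_fin uE//; apply: integral_ge0 => s sT.
by rewrite lee_fin G0.
Qed.

(* [tau] is replaced by a version whose sign is right everywhere, since the sections
   of the Green's function are not known to be measurable. *)
Lemma green_fun_pos n b T (G : R -> R -> R) z (tau : R -> R) :
  (0 < n)%N -> 0 < T ->
  green_fun (Lop n b) (XP n T) 0 T G -> XP n T z ->
  {ae mu, forall t, `[0, T]%classic t -> Lop n b z t = tau t} ->
  mu.-integrable `[0, T]%classic (EFin \o tau) ->
  (forall t s, `[0, T]%classic t -> `[0, T]%classic s -> 0 <= G t s) ->
  {ae mu, forall t, `[0, T]%classic t -> 0 <= tau t} ->
  forall t, `[0, T]%classic t -> 0 <= z t.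
Proof.
move=> n0 T0 GF Xz Lz itau G0 tau0.
apply: (@green_fun_ge0 n b T G z tau^\+ n0 T0 GF Xz).
- move: Lz tau0; apply: filterS2; first exact: (ae_filter_ringOfSetsType mu).
  by move=> t Lt t0 tT; rewrite Lt// /funrpos max_l// t0.
- by apply: integrable_funrpos => //; exact: measurable_itv.
- by move=> t s tT sT; rewrite mulr_ge0// ?G0// le_max lexx orbT.
Qed.

Lemma green_fun_neg n b T (G : R -> R -> R) z (tau : R -> R) :
  (0 < n)%N -> 0 < T ->
  green_fun (Lop n b) (XP n T) 0 T G -> XP n T z ->
  {ae mu, forall t, `[0, T]%classic t -> Lop n b z t = tau t} ->
  mu.-integrable `[0, T]%classic (EFin \o tau) ->
  (forall t s, `[0, T]%classic t -> `[0, T]%classic s -> G t s <= 0) ->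
  {ae mu, forall t, `[0, T]%classic t -> tau t <= 0} ->
  forall t, `[0, T]%classic t -> 0 <= z t.
Proof.
move=> n0 T0 GF Xz Lz itau G0 tau0.
have mI : measurable (`[0, T]%classic : set R) by exact: measurable_itv.
(* This version of [tau] is nonpositive everywhere; it is written as a combination to fit
   [integrable_lin]. *)
apply: (@green_fun_ge0 n b T G z (fun t => 0 + -1 * tau^\- t) n0 T0 GF Xz).
- move: Lz tau0; apply: filterS2; first exact: (ae_filter_ringOfSetsType mu).
  by move=> t Lt t0 tT; rewrite Lt// /funrneg max_l ?oppr_ge0 ?t0//; lra.
- apply: (@integrable_lin _ _ (cst 0)) => //; last exact: integrable_funrneg.
  exact: integrable0.
- move=> t s tT sT; rewrite mulr_le0 ?G0//.
  by rewrite add0r mulN1r oppr_le0 le_max lexx orbT.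
Qed.

End Green.

(** * Comparison of the Neumann and Dirichlet solutions *)

Theorem theorem6p2 (R : realType) (n : nat) (T : R) (alpha : \bar R)
    (a : nat -> R -> R) (GP : R -> R -> R) (sigma1 sigma2 uN uD : R -> R) :
  (1 <= n)%N -> 0 < T -> (1 <= alpha)%E ->
  (forall k, (k < 2 * n)%N -> Lalpha alpha T (a k)) ->
  green_fun (Lop n (aext T a)) (XP n (2 * T)) 0 (2 * T) GP ->
  nonresonant (Lop n a) (XN n T) 0 T ->
  nonresonant (Lop n a) (XD n T) 0 T ->
  (@lebesgue_measure R).-integrable `[0, T]%classic (EFin \o sigma1) ->
  (@lebesgue_measure R).-integrable `[0, T]%classic (EFin \o sigma2) ->
  XN n T uN ->
  {ae @lebesgue_measure R, forall t, `[0, T]%classic t -> Lop n a uN t = sigma1 t} ->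
  XD n T uD ->
  {ae @lebesgue_measure R, forall t, `[0, T]%classic t -> Lop n a uD t = sigma2 t} ->
  [/\
   ((forall t s, `[0, 2 * T]%classic t -> `[0, 2 * T]%classic s -> 0 <= GP t s) ->
    {ae @lebesgue_measure R, forall t, `[0, T]%classic t -> `|sigma2 t| <= sigma1 t} ->
    forall t, `[0, T]%classic t -> `|uD t| <= uN t),
   ((forall t s, `[0, 2 * T]%classic t -> `[0, 2 * T]%classic s -> GP t s <= 0) ->
    {ae @lebesgue_measure R, forall t, `[0, T]%classic t -> 0 <= sigma2 t <= sigma1 t} ->
    forall t, `[0, T]%classic t -> uN t <= 0 /\ uN t <= uD t) &
   ((forall t s, `[0, 2 * T]%classic t -> `[0, 2 * T]%classic s -> GP t s <= 0) ->
    {ae @lebesgue_measure R, forall t, `[0, T]%classic t -> sigma1 t <= sigma2 t <= 0} ->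
    forall t, `[0, T]%classic t -> 0 <= uN t /\ uD t <= uN t)].
Proof.
move=> n0 T0 _ _ GF _ _ i1 i2 XuN LuN XuD LuD.
have [WN bN] := XuN; have [WD bD] := XuD.
pose vN := reflect_ext 1 T uN; pose vD := reflect_ext (-1) T uD.
pose sN := reflect_ext 1 T sigma1; pose sD := reflect_ext (-1) T sigma2.
have T20 : 0 < 2 * T by rewrite mulr_gt0.
have half k : (k < 2 * n)%N -> (k./2 < n)%N.
  by move=> kn; rewrite -ltn_double -!muln2 mulnC [(n * 2)%N]mulnC mul2n;
    apply: leq_ltn_trans kn; rewrite -[leqRHS]odd_double_half leq_addl.
(* For odd [k] both sides vanish by the Neumann conditions; for even [k] the factor is 1. In the
   Dirichlet case below the parities are exchanged. *)
have NE k : (k < 2 * n)%N ->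
    derive1n k uN T = (-1) ^+ k * 1 * derive1n k uN T /\
    derive1n k uN 0 = (-1) ^+ k * 1 * derive1n k uN 0.
  move=> /half/bN[h1 h2]; have := odd_double_half k; rewrite -signr_odd -mul2n.
  case: odd => kE; last by rewrite expr0 !mul1r.
  by rewrite -kE add1n h1 h2 !mulr0.
have DE k : (k < 2 * n)%N ->
    derive1n k uD T = (-1) ^+ k * -1 * derive1n k uD T /\
    derive1n k uD 0 = (-1) ^+ k * -1 * derive1n k uD 0.
  move=> /half/bD[h1 h2]; have := odd_double_half k; rewrite -signr_odd -mul2n.
  case: odd => kE; first by rewrite expr1 mulrNN !mul1r.
  by rewrite -kE add0n h1 h2 !mulr0.
have XvN : XP n (2 * T) vN.
  by apply: reflect_ext_XP => // k /NE[].
have XvD : XP n (2 * T) vD.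
  by apply: reflect_ext_XP => // k /DE[].
have LvN : {ae @lebesgue_measure R, forall t, `[0, 2 * T]%classic t ->
    Lop n (aext T a) vN t = sN t}.
  by apply: Lop_reflect_ext => // k /NE[].
have LvD : {ae @lebesgue_measure R, forall t, `[0, 2 * T]%classic t ->
    Lop n (aext T a) vD t = sD t}.
  by apply: Lop_reflect_ext => // k /DE[].
have iN := integrable_reflect_ext 1 T0 i1.
have iD := integrable_reflect_ext (-1) T0 i2.
have mJ : measurable (`[0, 2 * T]%classic : set R) by exact: measurable_itv.
have vE t : `[0, T]%classic t ->
    [/\ `[0, 2 * T]%classic t, vN t = uN t & vD t = uD t].
  rewrite /= !in_itv/= => /andP[t0 tT]; rewrite /vN /vD /reflect_ext tT.
  by split=> //; lra.
(* Sign principles for the combination [z0 + c * z1]: only the signs of [GP] and of [s0 + c * s1]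
   remain to be supplied. *)
have pos c z0 z1 s0 s1 := fun X0 X1 L0 L1 I0 I1 => green_fun_pos n0 T20 GF
  (@XP_lin _ n (2 * T) c z0 z1 n0 X0 X1)
  (@Lop_XP_lin _ n (aext T a) (2 * T) c z0 z1 s0 s1 n0 T20 X0 X1 L0 L1)
  (@integrable_lin _ _ c s0 s1 mJ I0 I1).
have neg c z0 z1 s0 s1 := fun X0 X1 L0 L1 I0 I1 => green_fun_neg n0 T20 GF
  (@XP_lin _ n (2 * T) c z0 z1 n0 X0 X1)
  (@Lop_XP_lin _ n (aext T a) (2 * T) c z0 z1 s0 s1 n0 T20 X0 X1 L0 L1)
  (@integrable_lin _ _ c s0 s1 mJ I0 I1).
split=> G0 /ae_reflect_double hs t /vE[tJ <- <-].
(* The source is [sigma1 + sigma2] on the first half and the reflection of [sigma1 - sigma2] on the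
   second; both are nonnegative exactly under the bound on the absolute value. *)
- have h1 : 0 <= vN t + 1 * vD t.
    apply: (pos _ _ _ _ _ XvN XvD LvN LvD iN iD G0) tJ.
    apply: ae_imply hs => s hs /hs; rewrite /sN /sD /reflect_ext.
    by case: ifP => _; rewrite ler_norml => /andP[]; lra.
  have h2 : 0 <= vN t + -1 * vD t.
    apply: (pos _ _ _ _ _ XvN XvD LvN LvD iN iD G0) tJ.
    apply: ae_imply hs => s hs /hs; rewrite /sN /sD /reflect_ext.
    by case: ifP => _; rewrite ler_norml => /andP[]; lra.
  by rewrite ler_norml; lra.
(* The coefficient -2 expresses the opposite of [vN] in the available form. *)
- have h1 : 0 <= vN t + -2 * vN t.
    apply: (neg _ _ _ _ _ XvN XvN LvN LvN iN iN G0) tJ.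
    apply: ae_imply hs => s hs /hs; rewrite /sN /reflect_ext.
    by case: ifP => _ /andP[]; lra.
  (* On the second half the source reflects [- sigma2 - sigma1], so the sign of [sigma2] matters in
     addition to the ordering. *)
  have h2 : 0 <= vD t + -1 * vN t.
    apply: (neg _ _ _ _ _ XvD XvN LvD LvN iD iN G0) tJ.
    apply: ae_imply hs => s hs /hs; rewrite /sN /sD /reflect_ext.
    by case: ifP => _ /andP[]; lra.
  by split; lra.
(* The coefficient 0 gives [vN] alone. *)
- have h1 : 0 <= vN t + 0 * vN t.
    apply: (neg _ _ _ _ _ XvN XvN LvN LvN iN iN G0) tJ.
    apply: ae_imply hs => s hs /hs; rewrite /sN /reflect_ext.
    by case: ifP => _ /andP[]; lra.
  have h2 : 0 <= vN t + -1 * vD t.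
    apply: (neg _ _ _ _ _ XvN XvD LvN LvD iN iD G0) tJ.
    apply: ae_imply hs => s hs /hs; rewrite /sN /sD /reflect_ext.
    by case: ifP => _ /andP[]; lra.
  by split; lra.
Qed.
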